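(* Let $(\sigma_L,\sigma_R)\in\mathbb{R}^2$ satisfy $$\sigma_R>1,\qquad \sigma_L>\frac{\sigma_R-1}{\sigma_R\left(\sigma_R^2+1\right)},$$ and define $$\tau_R=-(\sigma_R+1),\qquad \delta_L=\frac{1-\sigma_L\sigma_R^2}{\sigma_R(\sigma_R+1)},\qquad \tau_L=\frac{1}{\sigma_R^2+1}-\frac{\sigma_L+\sigma_R}{\sigma_R+1},\qquad \delta_R=0,\qquad \mu=1 .$$ Let $f:\mathbb{R}^3\to\mathbb{R}^3$ be the piecewise-linear continuous map $$f(\mathbf{x})=\begin{cases}A_L\mathbf{x}+e_1\mu, & e_1^{\sf T}\mathbf{x}\le 0,\\ A_R\mathbf{x}+e_1\mu, & e_1^{\sf T}\mathbf{x}\ge 0,\end{cases}\qquad A_J=\begin{bmatrix}\tau_J&1&0\\-\sigma_J&0&1\\ \delta_J&0&0\end{bmatrix},\quad J\in\{L,R\},$$ where $e_1=(1,0,0)^{\sf T}$. Let $\mathcal{X}=RLR$ and $\mathcal{Y}=LR$. Then there exists an integer $k_{\rm min}\ge 0$ such that for every integer $k\ge k_{\rm min}$ the map $f$ has an admissible, asymptotically stable $\mathcal{X}^k\mathcal{Y}$-cycle with no points on $\Sigma=\{\mathbf{x}\in\mathbb{R}^3 : e_1^{\sf T}\mathbf{x}=0\}$.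
   Context: Write $f_L(\mathbf{x})=A_L\mathbf{x}+e_1\mu$ and $f_R(\mathbf{x})=A_R\mathbf{x}+e_1\mu$ for the two affine components of $f$. A word of length $n$ is an element $\mathcal{Z}=\mathcal{Z}_0\cdots\mathcal{Z}_{n-1}\in\{L,R\}^n$. For words $\mathcal{X},\mathcal{Y}$, $\mathcal{X}\mathcal{Y}$ denotes concatenation, and $\mathcal{X}^k$ ($k\ge0$) denotes the concatenation of $\mathcal{X}$ with itself $k$ times (so $\mathcal{X}^k\mathcal{Y}$ has length $3k+2$ for $\mathcal{X}=RLR$, $\mathcal{Y}=LR$). For a word $\mathcal{Z}$ of length $n$, a $\mathcal{Z}$-cycle is an $n$-tuple $(\mathbf{x}_0,\ldots,\mathbf{x}_{n-1})$ of points of $\mathbb{R}^3$ with $f_{\mathcal{Z}_i}(\mathbf{x}_i)=\mathbf{x}_{(i+1)\bmod n}$ for all $i=0,\ldots,n-1$. It is admissible if, for each $i$ with $\mathbf{x}_i\notin\Sigma$, one has $e_1^{\sf T}\mathbf{x}_i<0$ when $\mathcal{Z}_i=L$ and $e_1^{\sf T}\mathbf{x}_i>0$ when $\mathcal{Z}_i=R$; an admissible $\mathcal{Z}$-cycle is a periodic orbit of $f$. Asymptotic stability means asymptotic stability as a periodic orbit of $f$; for an admissible $\mathcal{Z}$-cycle with no points on $\Sigma$ this is equivalent to all eigenvalues of $A_{\mathcal{Z}_{n-1}}\cdots A_{\mathcal{Z}_0}$ having modulus less than $1$. *)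

(* Defs.v *)
From mathcomp Require Import all_boot all_order all_algebra.
From mathcomp Require Import all_classical all_reals all_analysis.

Set Implicit Arguments.
Unset Strict Implicit.
Unset Printing Implicit Defensive.

Import Order.TTheory GRing.Theory Num.Theory.
Import numFieldNormedType.Exports.

Local Open Scope classical_set_scope.
Local Open Scope ring_scope.

(* The real field is called K because R is a letter of the alphabet {L, R}. *)
Inductive letter := L | R.

Definition word := seq letter.

Definition word_pow (k : nat) (X : word) : word := flatten (nseq k X).

Definition companion_mx (K : realType) (tau sigma delta : K) : 'M[K]_3 :=
  \matrix_(i < 3, j < 3)
    (nth [::] [:: [:: tau;     1; 0];
                  [:: - sigma; 0; 1];
                  [:: delta;   0; 0]] i)`_j.

Definition e1 (K : realType) : 'cV[K]_3 := delta_mx 0 0.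

(* e_1^T x *)
Definition coord1 (K : realType) (x : 'cV[K]_3) : K := x 0 0.

Definition Sigma (K : realType) : set 'cV[K]_3 := [set x | coord1 x = 0].

Definition affine_piece (K : realType) (AL AR : 'M[K]_3) (mu : K) (s : letter)
    (x : 'cV[K]_3) : 'cV[K]_3 :=
  match s with L => AL | R => AR end *m x + mu *: e1 K.

(* For companion matrices the two pieces agree on Sigma, so the choice made
   there is immaterial: see [pwl_map_ge0]. *)
Definition pwl_map (K : realType) (AL AR : 'M[K]_3) (mu : K) (x : 'cV[K]_3) :
    'cV[K]_3 :=
  affine_piece AL AR mu (if coord1 x <= 0 then L else R) x.

Lemma pwl_map_le0 (K : realType) (AL AR : 'M[K]_3) (mu : K) (x : 'cV[K]_3) :
  coord1 x <= 0 -> pwl_map AL AR mu x = affine_piece AL AR mu L x.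
Proof. by rewrite /pwl_map => ->. Qed.

Lemma pwl_map_ge0 (K : realType) (tL sL dL tR sR dR mu : K) (x : 'cV[K]_3) :
  let AL := companion_mx tL sL dL in
  let AR := companion_mx tR sR dR in
  0 <= coord1 x -> pwl_map AL AR mu x = affine_piece AL AR mu R x.
Proof.
move=> AL AR x_ge0; rewrite /pwl_map; case: ifPn => // x_le0.
have x0 : x 0 0 = 0 by apply/le_anti/andP; split.
rewrite /affine_piece; congr (_ + _); apply/matrixP => i j.
rewrite !mxE !big_ord_recl !big_ord0 !mxE (ord1 j) x0 !mulr0.
by case: i => -[|[|[|//]]] i_lt3.
Qed.

(* [ordS i] is the index i + 1 taken modulo the length of Z. *)
Definition is_cycle (K : realType) (AL AR : 'M[K]_3) (mu : K) (Z : word)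
    (x : 'I_(size Z) -> 'cV[K]_3) : Prop :=
  forall i, affine_piece AL AR mu (tnth (in_tuple Z) i) (x i) = x (ordS i).

Definition admissible (K : realType) (Z : word)
    (x : 'I_(size Z) -> 'cV[K]_3) : Prop :=
  forall i, ~ Sigma (x i) ->
    match tnth (in_tuple Z) i with
    | L => coord1 (x i) < 0
    | R => 0 < coord1 (x i)
    end.

Definition lyapunov_stable (T : topologicalType) (f : T -> T) (O : set T) :
    Prop :=
  forall U : set T, set_nbhs O U ->
    exists2 V : set T, set_nbhs O V &
      forall x, V x -> forall m : nat, U (iter m f x).

Definition attracting (T : topologicalType) (f : T -> T) (O : set T) : Prop :=
  exists2 V : set T, set_nbhs O V &
    forall x, V x -> forall U : set T, set_nbhs O U ->
      \forall m \near \oo, U (iter m f x).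

(* For a periodic orbit, O is its (finite) set of points. *)
Definition asymptotically_stable (T : topologicalType) (f : T -> T)
    (O : set T) : Prop :=
  lyapunov_stable f O /\ attracting f O.

(* Main.v *)
(* Every point with symbol R is mapped into the plane x_3 = 0, on which the map
   of the word RLR is a saddle with eigenvalues lam > 1 and 1 / lam.  In
   eigencoordinates (y, z) centred at its fixed point the map of LR is
   (y, z) |-> (- lam z, y / (s^2 + 1) + beta z + shift): it sends the unstable
   line z = 0 into the stable line y = 0.  Hence on this plane the linear part
   of (RLR)^k LR has determinant 1 / s and trace beta / lam^k, so it is a
   contraction for large k, and the fixed point can be written down.  As k
   grows, the cycle approaches the homoclinic connection, on which all the
   admissibility inequalities hold strictly. *)

Require Import Defs.
From mathcomp Require Import all_boot all_order all_algebra.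
From mathcomp Require Import all_classical all_reals all_analysis.
From mathcomp Require Import ring lra.

Import Order.TTheory GRing.Theory Num.Theory.
Import numFieldNormedType.Exports.

Local Open Scope classical_set_scope.
Local Open Scope ring_scope.

(** * Asymptotic stability of a periodic orbit from its return map *)

Section stability.

Context {T : topologicalType}.
Implicit Types (f g : T -> T) (p : T).

(** By continuity along the orbit, [i * n.-1] further steps carry a neighbourhood of [iter i f p]
    close to [p], because [i + i * n.-1 = i * n]. From there the return map [iter n f] handles whole
    periods, and [stay] handles the fewer than [n] steps left over. *)
Lemma orbit_asymptotically_stable f p n :
  (0 < n)%N -> iter n f p = p ->
  (forall i, {for iter i f p, continuous f}) ->
  (forall U, nbhs p U ->
    \forall y \near p, forall q, U (iter (q * n) f y)) ->
  (\forall y \near p, iter (q * n) f y @[q --> \oo] --> p) ->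
  asymptotically_stable f [set iter i f p | i in setT].
Proof.
move=> n_gt0 fnp fc stab attr.
have fjc i j : {for iter i f p, continuous (iter j f)}.
  elim: j => [|j IHj]; first exact: cvg_id.
  have := fc (j + i)%N; rewrite iterD; exact: continuous_comp.
have back i U : nbhs p U -> nbhs (iter i f p) (iter (i * n.-1) f @^-1` U).
  move=> pU; apply: (fjc i (i * n.-1)%N); rewrite -iterD addnC -mulnS prednK//.
  by rewrite iterM (_ : iter i _ p = p)//; elim: (i) => //= ? ->.
have stay U i m : set_nbhs [set iter i f p | i in setT] U ->
    \forall y \near iter i f p, forall j, (j < m)%N -> U (iter j f y).
  move=> OU; elim: m => [|m IHm]; first exact: nearW.
  have Um : nbhs (iter i f p) (iter m f @^-1` U).
    by apply: (fjc i m); apply: OU; exists (m + i)%N => //; rewrite iterD.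
  near=> y => j; rewrite ltnS leq_eqVlt => /predU1P[->|j_lt].
    by near: y.
  by move: j j_lt; near: y.
have split_iter m y : iter m f y = iter (m %% n) f (iter (m %/ n * n) f y).
  by rewrite -iterD addnC -divn_eq.
split=> [U OU|].
  (* The largest candidate for [V]: forward invariance in [U] is then immediate, and only the
     neighbourhood property is left. *)
  exists [set y | forall m, U (iter m f y)]; last by [].
  move=> _ [i _ <-]; have := stab _ (stay U 0%N n OU) => /(back i) near_i.
  near=> y => m; have [m_lt|m_ge] := ltnP m (i * n.-1).
    by move: m m_lt; near: y; exact: stay.
  rewrite -(subnK m_ge) iterD split_iter.
  have : forall q j, (j < n)%N ->
      U (iter j f (iter (q * n) f (iter (i * n.-1) f y))) by near: y.
  by apply; rewrite ltn_pmod.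
exists [set y | forall U, set_nbhs [set iter i f p | i in setT] U ->
    \forall m \near \oo, U (iter m f y)]; last by [].
move=> _ [i _ <-]; have := back i _ attr; apply: filterS => y /= cvg_y U OU.
have [Q _ UQ] := cvg_y _ (stay U 0%N n OU).
(* First [i * n.-1] steps to come close to [p], then [Q] whole periods. *)
exists (Q * n + i * n.-1)%N => // m /= m_ge.
have m_ge' : (i * n.-1 <= m)%N by apply: leq_trans m_ge; rewrite leq_addl.
rewrite -(subnK m_ge') iterD split_iter; apply: UQ; last by rewrite ltn_pmod.
by rewrite /= leq_divRL// leq_subRL// addnC.
Unshelve. all: by end_near. Qed.

(** Meant for a set [S] with empty interior and a [d] that controls neighbourhoods of [p] only
    within [S]: one application of [g] enters [S], and from then on [d] decays geometrically. *)
Lemma contraction_attracts {K : realType} g p (S : set T) (d : T -> K)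
    (rho r0 : K) :
  0 <= rho < 1 -> 0 < r0 -> (forall y, 0 <= d y) ->
  (forall U, nbhs p U -> exists2 r, 0 < r & forall y, S y -> d y < r -> U y) ->
  (\forall y \near p, S (g y)) ->
  (forall r, 0 < r -> \forall y \near p, d (g y) < r) ->
  (forall y, S y -> d y < r0 -> S (g y) /\ d (g y) <= rho * d y) ->
  (forall U, nbhs p U -> \forall y \near p, forall q, U (iter q g y)) /\
  (\forall y \near p, iter q g y @[q --> \oo] --> p).
Proof.
move=> /andP[rho_ge0 rho_lt1] r0_gt0 d_ge0 dU Sg dg contr.
(* The first application only lands in [S] and need not contract, whence the exponent [q] for the
   iterate [q.+1]. *)
have decay y : S (g y) -> d (g y) < r0 -> forall q,
    S (iter q.+1 g y) /\ d (iter q.+1 g y) <= rho ^+ q * d (g y).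
  move=> Sy dy; elim=> [|q [IHS IHd]]; first by rewrite mul1r.
  have rhoq_le1 : rho ^+ q <= 1 by rewrite exprn_ile1// ltW.
  have dq_lt : d (iter q.+1 g y) < r0.
    by apply: le_lt_trans IHd _; apply: le_lt_trans dy; rewrite ler_piMl.
  have [S' d'] := contr _ IHS dq_lt.
  by split=> //; apply: le_trans d' _; rewrite exprS -mulrA ler_wpM2l.
split=> [U pU|].
  have [r r_gt0 rU] := dU _ pU.
  near=> y => -[|q]; first by near: y; exact: pU.
  have [||Sq dq] := decay y _ _ q.
  - by near: y.
  - by near: y; exact: dg.
  - apply: rU => //; apply: le_lt_trans dq _.
    have dy : d (g y) < r by near: y; exact: dg.
    by apply: le_lt_trans dy; rewrite ler_piMl// exprn_ile1// ltW.
near=> y => U /= pU; have [r r_gt0 rU] := dU _ pU.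
have Sy : S (g y) by near: y.
have dy : d (g y) < r0 by near: y; exact: dg.
have rho_cvg : rho ^+ q * d (g y) @[q --> \oo] --> (0 : K).
  rewrite -[X in _ --> X](mul0r (d (g y))); apply: cvgMl.
  by apply: cvg_expr; rewrite ger0_norm.
have [Q _ rQ] := cvgr_lt _ rho_cvg r r_gt0.
exists Q.+1 => // -[//|q] /= Q_le; have [Sq dq] := decay y Sy dy q.
by apply: rU => //; apply: le_lt_trans dq _; exact: rQ.
Unshelve. all: by end_near. Qed.

End stability.

Lemma cvg_mx_coord {U : Type} (F : set_system U) {FF : Filter F}
    {T : topologicalType} m n (f : U -> 'M[T]_(m, n)) (M : 'M[T]_(m, n)) :
  (forall i j, f x i j @[x --> F] --> M i j) -> f x @[x --> F] --> M.
Proof.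
move=> fM A [P MP PA].
have : \forall x \near F, forall i j, P i j (f x i j).
  by apply: filter_forall => i; apply: filter_forall => j; exact: fM.
by apply: filterS => x; exact: PA.
Qed.

(** * Words of affine pieces, itineraries and cycles *)

Section itineraries.

Context {K : realType} (AL AR : 'M[K]_3) (mu : K).
Implicit Types (c : letter) (w : word) (x : 'cV[K]_3).

Local Notation F := (affine_piece AL AR mu).
Local Notation f := (pwl_map AL AR mu).

Lemma affine_piece_continuous c : continuous (F c).
Proof.
move=> x; apply: (@cvg_mx_coord _ (nbhs x)) => i j; rewrite /affine_piece.
under eq_fun do rewrite !mxE.
rewrite !mxE; apply: cvgD; last exact: cvg_cst.
apply: (@cvg_big _ _ +%R) => // [|k _]; first exact: add_continuous.
by apply: cvgM; [exact: cvg_cst|exact: coord_continuous].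
Qed.

Definition on_side c x :=
  match c with L => coord1 x < 0 | R => 0 < coord1 x end.

Lemma near_on_side c x : on_side c x -> \forall y \near x, on_side c y.
Proof.
have c1 : coord1 y @[y --> x] --> coord1 x by exact: coord_continuous.
by case: c => /= ?; [exact: (cvgr_lt _ c1)|exact: (cvgr_gt _ c1)].
Qed.

Lemma pwl_map_on_side c x : on_side c x -> f x = F c x.
Proof.
by case: c; rewrite /pwl_map /= => x0; [rewrite ltW|rewrite leNgt x0].
Qed.

Lemma pwl_map_continuous_at c x : on_side c x -> {for x, continuous f}.
Proof.
move=> cx; rewrite /prop_for /continuous_at (pwl_map_on_side c)//.
apply: cvg_trans (affine_piece_continuous c x);
apply: (@near_eq_cvg _ _ (nbhs x)).
by near=> y; rewrite (pwl_map_on_side c)//; near: y; exact: near_on_side.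
Unshelve. all: by end_near. Qed.

(** Off [Sigma] the map agrees locally with a single affine piece; this covers every point of the
    cycles considered. *)
Lemma pwl_map_continuous_off_Sigma x : ~ Sigma x -> {for x, continuous f}.
Proof.
rewrite /Sigma /= => /eqP; rewrite neq_lt => /orP[x0|x0].
- exact: (pwl_map_continuous_at L).
- exact: (pwl_map_continuous_at R).
Qed.

(** [run] ignores the sides and is thus an explicit affine map; [follows] is the condition under
    which it agrees with iteration of [f]. The sides in [follows] are strict, so that the condition
    is open. *)
Definition run x w := foldl (fun y c => F c y) x w.

Fixpoint follows x w :=
  if w is c :: w' then on_side c x /\ follows (F c x) w' else True.

Lemma run_cat x w1 w2 : run x (w1 ++ w2) = run (run x w1) w2.
Proof. exact: foldl_cat. Qed.

Lemma run_continuous w : continuous (run^~ w).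
Proof.
elim: w => [|c w IHw] x; first exact: cvg_id.
apply: (@continuous_comp _ _ _ (F c) (run^~ w)); last exact: IHw.
exact: affine_piece_continuous.
Qed.

Lemma follows_cat x w1 w2 :
  follows x w1 -> follows (run x w1) w2 -> follows x (w1 ++ w2).
Proof.
by elim: w1 x => //= c w1 IHw x [cx fx] ?; split=> //; exact: IHw.
Qed.

Lemma near_follows w x : follows x w -> \forall y \near x, follows y w.
Proof.
elim: w x => [|c w IHw] x /=; first by move=> _; near=> y.
move=> [cx /IHw fx]; near=> y; split; near: y; first exact: near_on_side.
exact: (affine_piece_continuous c x _ fx).
Unshelve. all: by end_near. Qed.

Lemma follows_iter x w i : follows x w -> (i <= size w)%N ->
  iter i f x = run x (take i w).
Proof.
elim: w x i => [|c w IHw] x [|i]//= [cx fx] ilt.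
by rewrite -iterS iterSr (pwl_map_on_side c)// IHw.
Qed.

Lemma follows_nth x w i : follows x w -> (i < size w)%N ->
  on_side (nth L w i) (run x (take i w)).
Proof. by elim: w x i => [//|c w IHw] x [|i] [cx fx]//= ?; exact: IHw. Qed.

Lemma run_take_S x w i : (i < size w)%N ->
  run x (take i.+1 w) = F (nth L w i) (run x (take i w)).
Proof. by move=> ilt; rewrite (take_nth L)// -cats1 run_cat. Qed.

(** The points are the runs along the prefixes of [w]. The orbit is also given as the set of all
    iterates, the form used by the stability criterion. *)
Lemma cycle_of_fixed_run x w : (0 < size w)%N -> follows x w ->
    run x w = x ->
  exists y : 'I_(size w) -> 'cV[K]_3,
    [/\ is_cycle AL AR mu y, admissible y, forall i, ~ Sigma (y i) &
        range y = [set iter i f x | i in setT]].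
Proof.
move=> w_gt0 fx xw.
exists (fun i : 'I_(size w) => run x (take i w)).
have side (i : 'I_(size w)) :
    on_side (tnth (in_tuple w) i) (run x (take i w)).
  by rewrite (tnth_nth L); exact: follows_nth.
split.
- move=> i; rewrite (tnth_nth L) /= -run_take_S//.
  have [iS|iS] := ltnP i.+1 (size w); first by rewrite modn_small.
  have -> : i.+1 = size w by apply/eqP; rewrite eqn_leq iS andbT.
  by rewrite modnn take_size take0.
- by move=> i _; have := side i; move: (tnth _ _) => -[].
- move=> i; have := side i; rewrite /Sigma /=.
  by move: (tnth _ _) => -[] /= + x0; rewrite x0 ltxx.
- have itw : iter (size w) f x = x
    by rewrite (follows_iter x w _ fx)// take_size.
  apply/seteqP; split=> [_ [i _ <-]|_ [i _ <-]].
    by exists (nat_of_ord i) => //; rewrite (follows_iter x w i fx)// ltnW.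
  have ilt : (i %% size w < size w)%N by rewrite ltn_pmod.
  exists (Ordinal ilt) => //=; rewrite -(follows_iter x w _ fx) ?(ltnW ilt)//.
  rewrite [in RHS](divn_eq i (size w)) addnC iterD iterM.
  by congr iter; elim: (i %/ _)%N => //= ? <-.
Qed.

End itineraries.

Definition pt3 {K : realType} (a b c : K) : 'cV[K]_3 :=
  \col_(i < 3) [:: a; b; c]`_i.

Lemma coord1_pt3 (K : realType) (a b c : K) : coord1 (pt3 a b c) = a.
Proof. by rewrite /coord1 !mxE. Qed.

Lemma pt3_eta (K : realType) (x : 'cV[K]_3) : x = pt3 (x 0 0) (x 1 0) (x 2 0).
Proof.
apply/matrixP => i j; rewrite ord1 mxE.
by case: i => -[|[|[|//]]] i_lt3 /=; congr (x _ _); apply: val_inj.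
Qed.

Lemma companion_affine_pt3 (K : realType) (tau sigma delta a b c : K) :
  companion_mx tau sigma delta *m pt3 a b c + 1 *: e1 K =
  pt3 (tau * a + b + 1) (- sigma * a + c) (delta * a).
Proof.
apply/matrixP => i j; rewrite !mxE !big_ord_recl big_ord0 !mxE (ord1 j).
by case: i => -[|[|[|//]]] i_lt3; rewrite ?eqE /=; ring.
Qed.

(** * The affine pieces in eigencoordinates of the RLR-map *)

Section homoclinic_tangency.

Context {K : realType} (a s : K).
Hypotheses (s_gt1 : 1 < s) (a_gt : (s - 1) / (s * (s ^+ 2 + 1)) < a).

Let tL : K := 1 / (s ^+ 2 + 1) - (a + s) / (s + 1).
Let dL : K := (1 - a * s ^+ 2) / (s * (s + 1)).
Let tR : K := - (s + 1).

Let AL := companion_mx tL a dL.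
Let AR := companion_mx tR s 0.
Local Notation F := (affine_piece AL AR 1).

(** [D] is both the common denominator of the RLR fixed point and the determinant of its eigenvector
    basis. [shift] is the [z]-coordinate of the image of that fixed point under LR. *)
Let D : K := s ^+ 2 - s + 1.
Let lam : K := (s ^+ 2 + 1) / s.
Let beta : K := - (s + 1) / (s ^+ 2 + 1).
Let shift : K := (s ^+ 2 + s + 1) / ((s ^+ 2 + 1) * D).
(** [0 < H] is [a_gt] cleared of denominators. As [H / (D * (s + 1))] is the first coordinate of the
    last point of the RLR-cycle, it says that this point lies on the right. *)
Let H : K := s * (s ^+ 2 + 1) * a - (s - 1).

(* [pl y z] has coordinates [y], [z] with respect to the fixed point of the
   RLR-map in the plane [x_3 = 0] and the eigenvectors (s, s - 1), (1 - s, 1)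
   of its linear part, whose eigenvalues are [lam] and [1 / lam]. *)
Let pl (y z : K) : 'cV[K]_3 :=
  pt3 (s ^+ 2 / D + s * y + (1 - s) * z) (- D^-1 + (s - 1) * y + z) 0.

Lemma s_gt0 : 0 < s. Proof. exact: lt_trans s_gt1. Qed.
Lemma D_gt0 : 0 < D. Proof. by have := s_gt1; rewrite /D; nra. Qed.
Lemma s2D1_gt0 : 0 < s ^+ 2 + 1. Proof. by have := s_gt1; nra. Qed.
Lemma sD1_gt0 : 0 < s + 1. Proof. by have := s_gt1; nra. Qed.
Lemma H_gt0 : 0 < H.
Proof.
have s_gt0 := s_gt0; have s2D1_gt0 := s2D1_gt0.
move: a_gt; rewrite ltr_pdivrMr ?mulr_gt0// /H; nra.
Qed.
Lemma denominators_neq0 : [/\ s != 0, D != 0, s ^+ 2 + 1 != 0 & s + 1 != 0].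
Proof. by split; apply: lt0r_neq0;
  [exact: s_gt0|exact: D_gt0|exact: s2D1_gt0|exact:sD1_gt0]. Qed.

Lemma FR_pl y z : F R (pl y z) =
  pt3 (- s * (s ^+ 2 + 1) / D - (s ^+ 2 + 1) * y + s ^+ 2 * z)
    (- s * (s ^+ 2 / D + s * y + (1 - s) * z)) 0.
Proof.
have [s0 D0 s20 s10] := denominators_neq0.
rewrite /affine_piece companion_affine_pt3; congr pt3;
  rewrite ?mulr0 ?mul0r ?addr0//; move: D0; rewrite /tR /D => D0.
by field.
Qed.

Lemma coord1_FL_pl y z : coord1 (F L (pl y z)) =
  (- s * H / ((s ^+ 2 + 1) * D) - y * H / (s ^+ 2 + 1) +
   z * ((1 - s ^+ 2) / (s ^+ 2 + 1) - (1 - s) * (a + s) + s + 1)) / (s + 1).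
Proof.
have [s0 D0 s20 s10] := denominators_neq0.
rewrite /affine_piece companion_affine_pt3 coord1_pt3.
move: D0; rewrite /tL /D /H => D0.
by field; rewrite s10 s20 D0.
Qed.

Lemma coord1_FLR_pl y z : coord1 (F L (F R (pl y z))) =
  (H / D + y * (s ^+ 2 + 1) * (a - 1) - z * s * H / (s ^+ 2 + 1)) / (s + 1).
Proof.
have [s0 D0 s20 s10] := denominators_neq0.
rewrite FR_pl /affine_piece companion_affine_pt3 coord1_pt3.
move: D0; rewrite /tL /D /H => D0.
by field; rewrite s10 s20 D0.
Qed.

Lemma FRL_pl y z : F R (F L (pl y z)) =
  pl (- lam * z) (y / (s ^+ 2 + 1) + beta * z + shift).
Proof.
have [s0 D0 s20 s10] := denominators_neq0.
rewrite /pl /affine_piece !companion_affine_pt3.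
move: D0; rewrite /tL /tR /dL /lam /beta /shift /D => D0.
by congr pt3; field; rewrite ?s0 ?s10 ?s20 ?D0.
Qed.

Lemma FRLR_pl y z : F R (F L (F R (pl y z))) = pl (lam * y) (z / lam).
Proof.
have [s0 D0 s20 s10] := denominators_neq0.
rewrite /pl /affine_piece !companion_affine_pt3.
move: D0; rewrite /tL /tR /dL /lam /beta /shift /D => D0.
by congr pt3; field; rewrite ?s0 ?s10 ?s20 ?D0.
Qed.

(** * Powers of RLR and the sides of the cycle points *)

Let X : word := [:: R; L; R].
Local Notation run := (run AL AR 1).
Local Notation follows := (follows AL AR 1).

Lemma lam_gt1 : 1 < lam.
Proof. by rewrite /lam ltr_pdivlMr ?s_gt0// mul1r; have := s_gt1; nra. Qed.

Lemma lam_gt0 : 0 < lam. Proof. exact: lt_trans lam_gt1. Qed.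

Lemma run_X_pow j y z :
  run (pl y z) (word_pow j X) = pl (lam ^+ j * y) (z / lam ^+ j).
Proof.
elim: j y z => [|j IHj] y z; first by rewrite /= mul1r divr1.
have -> : word_pow j.+1 X = X ++ word_pow j X by [].
rewrite run_cat [run _ X]FRLR_pl IHj; congr pl; first by rewrite exprSr mulrA.
by rewrite -mulrA -[X in _ * X]invfM -exprS.
Qed.

Lemma run_cycle k y z : run (pl y z) (word_pow k X ++ [:: L; R]) =
  pl (- lam * (z / lam ^+ k))
     (lam ^+ k * y / (s ^+ 2 + 1) + beta * (z / lam ^+ k) + shift).
Proof. by rewrite run_cat run_X_pow [LHS]FRL_pl. Qed.

(** The third row of [AR] vanishes, so one turn brings any point of space into the plane where the
    contraction is proved. *)
Lemma run_end_R x w : run x (w ++ [:: L; R]) 2 0 = 0.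
Proof.
rewrite run_cat /= [X in affine_piece _ _ _ R X]pt3_eta.
by rewrite /affine_piece companion_affine_pt3 !mxE /= mul0r.
Qed.

(* On the cycle [y = - al * z0] and [z = ga * z0] with [al * ga = eps], so
   [(1 - al) * (1 - ga) >= 0] bounds [al + ga] by [1 + eps]. *)
Lemma follows_X al ga eps z0 : 0 < z0 -> 0 <= al <= 1 -> 0 <= ga <= 1 ->
  al * ga <= eps -> z0 * D * (1 + eps) < s ->
  follows (pl (- al * z0) (ga * z0)) X.
Proof.
move=> z0_gt0 /andP[al_ge0 al_le1] /andP[ga_ge0 ga_le1] alga z0_lt.
have [s0 D0 s20 s10] := denominators_neq0; have D_gt0 := D_gt0;
have H_gt0 := H_gt0.
have s_gt0 := s_gt0; have s2D1_gt0 := s2D1_gt0; have sD1_gt0 := sD1_gt0.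
(* Up to sign and a positive factor, each first coordinate below is a combination, with nonnegative
   coefficients, of the slack [s - z0 * D * (al + ga)], [z0 * D * al] and [z0 * D * ga]. *)
have t_lt : z0 * D * (al + ga) < s.
  apply: le_lt_trans z0_lt; rewrite ler_pM2l ?mulr_gt0//; nra.
have al_ge0' : 0 <= z0 * D * al by rewrite !mulr_ge0// ltW.
have ga_ge0' : 0 <= z0 * D * ga by rewrite !mulr_ge0// ltW.
split; [|split; [|split]] => //; rewrite /on_side.
- rewrite coord1_pt3.
  have -> : s ^+ 2 / D + s * (- al * z0) + (1 - s) * (ga * z0) =
      (s * (s - z0 * D * (al + ga)) + z0 * D * ga) / D by field.
  apply: divr_gt0 => //; nra.
- rewrite FR_pl coord1_pt3.
  have -> : - s * (s ^+ 2 + 1) / D - (s ^+ 2 + 1) * (- al * z0) +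
      s ^+ 2 * (ga * z0) = - ((s ^+ 2 + 1) * (s - z0 * D * (al + ga)) +
      z0 * D * ga) / D by field.
  rewrite mulNr oppr_lt0; apply: divr_gt0 => //; nra.
- rewrite coord1_FLR_pl; apply: divr_gt0 => //.
  have -> : H / D + - al * z0 * (s ^+ 2 + 1) * (a - 1) -
      ga * z0 * s * H / (s ^+ 2 + 1) =
      (H / s * (s - z0 * D * (al + ga))
       + z0 * D * al * (H / s - (s ^+ 2 + 1) * (a - 1))
       + z0 * D * ga * (H / s - s * H / (s ^+ 2 + 1))) / D.
    by field; rewrite s0 D0 s20.
  apply: divr_gt0 => //; apply: ltr_wpDr.
    apply: mulr_ge0 => //.
    have -> : H / s - s * H / (s ^+ 2 + 1) = H / (s * (s ^+ 2 + 1)).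
      by field; rewrite s0 s20.
    by apply: divr_ge0; rewrite ltW// mulr_gt0.
  apply: ltr_wpDr; last by rewrite mulr_gt0 ?divr_gt0// subr_gt0.
  apply: mulr_ge0 => //.
  (* The parameter [a] cancels, so the sign depends on [s] alone. *)
  have -> : H / s - (s ^+ 2 + 1) * (a - 1) = (s * s ^+ 2 + 1) / s.
    by rewrite /H; field.
  by apply: divr_ge0; rewrite ltW// ltr_wpDr// mulr_gt0// exprn_gt0.
Qed.

Let cLR : K := (1 - s ^+ 2) / (s ^+ 2 + 1) - (1 - s) * (a + s) + s + 1.

(** The final LR starts at this point, with [q] the inverse of [lam ^+ k]. The first inequality on
    [z0 * D] drops a positive term in [q]; the second is the exact numerator, whose [cLR] term fades
    as [q] tends to 0. *)
Lemma follows_LR q z0 : 0 < z0 -> 0 < q -> s ^+ 2 < (s ^+ 2 + 1) * (z0 * D) ->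
  0 < H / (s ^+ 2 + 1) * (lam * (z0 * D) - s) + q * (z0 * D) * cLR ->
  follows (pl (- lam * z0) (q * z0)) [:: L; R].
Proof.
move=> z0_gt0 q_gt0 hL hR.
have [s0 D0 s20 s10] := denominators_neq0; have D_gt0 := D_gt0;
have sD1_gt0 := sD1_gt0.
have qz : 0 < q * (z0 * D) by rewrite !mulr_gt0.
split; [|split] => //; rewrite /on_side.
- rewrite coord1_pt3.
  have -> : s ^+ 2 / D + s * (- lam * z0) + (1 - s) * (q * z0) =
      - ((s ^+ 2 + 1) * (z0 * D) - s ^+ 2 + (s - 1) * (q * (z0 * D))) / D.
    by rewrite /lam; field; rewrite s0 D0.
  rewrite mulNr oppr_lt0; apply: divr_gt0 => //; have := s_gt1; nra.
- rewrite coord1_FL_pl -/cLR; apply: divr_gt0 => //.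
  rewrite [ltRHS](_ : _ = (H / (s ^+ 2 + 1) * (lam * (z0 * D) - s) +
    q * (z0 * D) * cLR) / D); first exact: divr_gt0.
  by field; rewrite s20 D0.
Qed.

(** * The fixed point of the cycle map and its limit *)

Let q k : K := (lam ^+ k)^-1.
(** The first coordinate of the fixed-point equation gives [y = - lam * q k * z]. Substituted into
    the second, it leaves [z = - z / s + beta * q k * z + shift]. *)
Let z0 k : K := shift / (1 + s^-1 - beta * q k).
Let y0 k : K := - lam * q k * z0 k.
Let p k := pl (y0 k) (z0 k).
Let cyc k : word := word_pow k X ++ [:: L; R].

Lemma q_gt0 k : 0 < q k.
Proof. by rewrite invr_gt0 exprn_gt0// lam_gt0. Qed.

Lemma z0_denominator_gt0 k : 0 < 1 + s^-1 - beta * q k.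
Proof.
rewrite addr_gt0 ?addr_gt0 ?invr_gt0 ?s_gt0// oppr_gt0.
by rewrite pmulr_llt0 ?q_gt0// /beta mulNr oppr_lt0 divr_gt0 ?sD1_gt0 ?s2D1_gt0.
Qed.

Lemma z0_gt0 k : 0 < z0 k.
Proof.
have s2D1_gt0 := s2D1_gt0; have D_gt0 := D_gt0; have s_gt0 := s_gt0.
by rewrite divr_gt0 ?z0_denominator_gt0// /shift divr_gt0 ?mulr_gt0//
  ?addr_gt0// exprn_gt0.
Qed.

Lemma run_fixed k : run (p k) (cyc k) = p k.
Proof.
have [s0 D0 s20 s10] := denominators_neq0;
have w0 := lt0r_neq0 (z0_denominator_gt0 k).
have Q0 : lam ^+ k != 0 by rewrite -invr_eq0 lt0r_neq0// q_gt0.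
rewrite /p run_cycle; congr pl; first by rewrite /y0 -/(q k); ring.
rewrite -/(q k) /y0 (_ : lam ^+ k * _ = - lam * z0 k); last first.
  by rewrite /q; field.
apply/eqP; rewrite -subr_eq0; apply/eqP.
rewrite (_ : _ - _ = shift - z0 k * (1 + s^-1 - beta * q k)); last first.
  by rewrite /lam; field; rewrite s0 s20.
by rewrite /z0 divfK// subrr.
Qed.

(** The block RLR number [i] starts with [al = lam ^+ i.+1 * q k] and [ga] the inverse of
    [lam ^+ i]. Their product [lam * q k] is independent of [i], so one inequality serves all
    blocks. *)
Lemma follows_cycle k : z0 k * D * (1 + lam * q k) < s ->
  s ^+ 2 < (s ^+ 2 + 1) * (z0 k * D) ->
  0 < H / (s ^+ 2 + 1) * (lam * (z0 k * D) - s) + q k * (z0 k * D) * cLR ->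
  follows (p k) (cyc k).
Proof.
move=> hX hL hR; have lam_gt0 := lam_gt0.
have lam0 := lt0r_neq0 lam_gt0.
have lamX0 i : lam ^+ i != 0 by rewrite expf_neq0.
apply: follows_cat; last first.
  rewrite run_X_pow (_ : _ * y0 k = - lam * z0 k);
    last by rewrite /y0 /q; field.
  rewrite [_ / _]mulrC; apply: follows_LR => //; [exact: z0_gt0|exact: q_gt0].
(* Induction on the number [j] of blocks left needs the number [i] of blocks already run to vary. *)
have step i j : (i + j <= k)%N ->
    follows (pl (lam ^+ i * y0 k) (z0 k / lam ^+ i)) (word_pow j X).
  elim: j i => [//|j IHj] i ijk.
  have -> : word_pow j.+1 X = X ++ word_pow j X by [].
  apply: follows_cat; last first.
    rewrite [run _ X]FRLR_pl mulrA -exprS -mulrA -invfM -exprSr.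
    by apply: IHj; rewrite addSnnS.
  have -> : lam ^+ i * y0 k = - (lam ^+ i.+1 * q k) * z0 k.
    by rewrite /y0 exprS; ring.
  rewrite [z0 k / _]mulrC; apply: follows_X hX; first exact: z0_gt0.
  - rewrite mulr_ge0 ?exprn_ge0 ?(ltW lam_gt0) ?(ltW (q_gt0 k))//=.
    rewrite /q ler_pdivrMr ?exprn_gt0// mul1r ler_eXn2l ?lam_gt1//.
    by apply: leq_trans ijk; rewrite addnS ltnS leq_addr.
  - rewrite invr_ge0 exprn_ge0 ?(ltW lam_gt0)//= invf_le1 ?exprn_gt0//.
    by rewrite exprn_ege1// ltW// lam_gt1.
  - by rewrite exprS le_eqVlt; apply/orP; left; apply/eqP; field.
have := step 0%N k (leqnn _).
by rewrite mul1r divr1.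
Qed.

(** The first three bounds give admissibility, the last one contraction. Each is strict at the limit
    [q k = 0], hence holds for large [k]. *)
Lemma eventually_bounds : \forall k \near \oo,
  [/\ z0 k * D * (1 + lam * q k) < s,
      s ^+ 2 < (s ^+ 2 + 1) * (z0 k * D),
      0 < H / (s ^+ 2 + 1) * (lam * (z0 k * D) - s) + q k * (z0 k * D) * cLR &
      - beta * q k < (s - 1) ^+ 2 / (2 * s * (s + 1))].
Proof.
have [s0 D0 s20 s10] := denominators_neq0; have D_gt0 := D_gt0;
have s_gt0 := s_gt0.
have sD1_gt0 := sD1_gt0; have s2D1_gt0 := s2D1_gt0.
have q_cvg : q k @[k --> \oo] --> 0.
  under eq_fun do rewrite /q -exprVn.
  apply: cvg_expr; have lam_gt0 := lam_gt0.
  by rewrite ger0_norm ?invr_ge0 ?ltW// invf_lt1// lam_gt1.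
(* The value of [z0 k * D] on the homoclinic connection, obtained by putting [q k = 0]. *)
pose zoo := s * (s ^+ 2 + s + 1) / ((s + 1) * (s ^+ 2 + 1)).
have z_cvg : z0 k * D @[k --> \oo] --> zoo.
  have -> : zoo = shift / (1 + s^-1 - beta * 0) * D.
    rewrite /zoo /shift mulr0 subr0; field.
    by rewrite s0 D0 s20 s10.
  apply: cvgM; last exact: cvg_cst.
  apply: cvgM; first exact: cvg_cst.
  apply: cvgV.
    by rewrite mulr0 subr0 lt0r_neq0// addr_gt0 ?invr_gt0.
  apply: cvgB; first exact: cvg_cst.
  by apply: cvgM => //; exact: cvg_cst.
have c1 : z0 k * D * (1 + lam * q k) @[k --> \oo] --> zoo * (1 + lam * 0).
  apply: cvgM => //; apply: cvgD; first exact: cvg_cst.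
  by apply: cvgM => //; exact: cvg_cst.
have c2 : (s ^+ 2 + 1) * (z0 k * D) @[k --> \oo] --> (s ^+ 2 + 1) * zoo.
  by apply: cvgM => //; exact: cvg_cst.
have c3 : H / (s ^+ 2 + 1) * (lam * (z0 k * D) - s) + q k * (z0 k * D) * cLR
    @[k --> \oo] --> H / (s ^+ 2 + 1) * (lam * zoo - s) + 0 * zoo * cLR.
  apply: cvgD.
    apply: cvgM; first exact: cvg_cst.
    apply: cvgB; last exact: cvg_cst.
    by apply: cvgM => //; exact: cvg_cst.
  apply: cvgM; last exact: cvg_cst.
  exact: cvgM.
have c4 : - beta * q k @[k --> \oo] --> - beta * 0.
  by apply: cvgM => //; exact: cvg_cst.
near=> k; split; near: k.
- apply: (cvgr_lt _ c1); rewrite mulr0 addr0 mulr1 /zoo.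
  by rewrite ltr_pdivrMr ?mulr_gt0// ltr_pM2l//; have := s_gt1; nra.
- apply: (cvgr_gt _ c2).
  rewrite (_ : _ * zoo = s * (s ^+ 2 + s + 1) / (s + 1)); last first.
    by rewrite /zoo; field; rewrite s20 s10.
  by rewrite ltr_pdivlMr//; have := s_gt1; nra.
- apply: (cvgr_gt _ c3); rewrite !mul0r addr0.
  rewrite mulr_gt0 ?divr_gt0 ?H_gt0//.
  rewrite (_ : _ - _ = (s + 1)^-1) ?invr_gt0//.
  by rewrite /zoo /lam; field; rewrite s0 s20 s10.
- apply: (cvgr_lt _ c4); rewrite mulr0; apply: divr_gt0;
    last by rewrite !mulr_gt0.
  by rewrite exprn_gt0// subr_gt0.
Unshelve. all: by end_near. Qed.

(** * Contraction on the plane in a weighted norm *)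

Let yc (x : 'cV[K]_3) :=
  (x 0 0 - s ^+ 2 / D - (1 - s) * (x 1 0 + D^-1)) / D.
Let zc (x : 'cV[K]_3) :=
  (s * (x 1 0 + D^-1) - (s - 1) * (x 0 0 - s ^+ 2 / D)) / D.

(** [yc] and [zc] are Cramer's rule for the eigenvector basis. *)
Lemma pl_coords (x : 'cV[K]_3) : x 2 0 = 0 -> x = pl (yc x) (zc x).
Proof.
have [s0 D0 s20 s10] := denominators_neq0; move=> x2.
rewrite [LHS]pt3_eta x2 /pl /yc /zc.
by move: D0; rewrite /D => D0; congr pt3; field; rewrite D0.
Qed.

Lemma yc_pl y z : yc (pl y z) = y.
Proof.
have [s0 D0 s20 s10] := denominators_neq0; rewrite /yc !mxE /=.
by move: D0; rewrite /D => D0; field; rewrite D0.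
Qed.

Lemma zc_pl y z : zc (pl y z) = z.
Proof.
have [s0 D0 s20 s10] := denominators_neq0; rewrite /zc !mxE /=.
by move: D0; rewrite /D => D0; field; rewrite D0.
Qed.

(* In the basis of eigenvectors the linear part of the k-th cycle is
   [[0, - lam * q], [1 / (q * (s^2 + 1)), beta * q]]; the weight below balances
   its off-diagonal entries, whose product is [- 1 / s]. *)
Let weight k : K := 2 / ((s + 1) * (lam * q k)).
Let dist k (x : 'cV[K]_3) :=
  weight k * `|yc x - y0 k| + `|zc x - z0 k|.

Lemma weight_gt0 k : 0 < weight k.
Proof.
by apply: divr_gt0 => //; apply: mulr_gt0; rewrite ?sD1_gt0// mulr_gt0 ?lam_gt0
  ?q_gt0.
Qed.

Lemma dist_ge0 k x : 0 <= dist k x.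
Proof. by rewrite addr_ge0// mulr_ge0// ltW// weight_gt0. Qed.

Lemma dist_cycle_point k : dist k (p k) = 0.
Proof. by rewrite /dist yc_pl zc_pl !subrr normr0 mulr0 addr0. Qed.

Lemma dist_cvg (F : set_system 'cV[K]_3) {FF : Filter F} k (x : 'cV[K]_3) :
  (forall i j, y i j @[y --> F] --> x i j) ->
  dist k y @[y --> F] --> dist k x.
Proof.
move=> Fx; have y0c c : y 0 0 - c @[y --> F] --> x 0 0 - c.
  by apply: cvgB; [exact: Fx|exact: cvg_cst].
have y1c c : y 1 0 + c @[y --> F] --> x 1 0 + c.
  by apply: cvgD; [exact: Fx|exact: cvg_cst].
apply: cvgD.
  apply: cvgM; first exact: cvg_cst.
  apply: cvg_norm; apply: cvgB; last exact: cvg_cst.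
  apply: cvgM; last exact: cvg_cst.
  apply: cvgB; first exact: y0c.
  by apply: cvgM; [exact: cvg_cst|exact: y1c].
apply: cvg_norm; apply: cvgB; last exact: cvg_cst.
apply: cvgM; last exact: cvg_cst.
by apply: cvgB; (apply: cvgM; [exact: cvg_cst|]); [exact: y1c|exact: y0c].
Qed.

Lemma dist_continuous k : continuous (dist k).
Proof. by move=> x;
apply: (@dist_cvg (nbhs x)) => i j; exact: coord_continuous. Qed.

Lemma dist_nbhs k U : nbhs (p k) U ->
  exists2 r, 0 < r & forall x : 'cV[K]_3, x 2 0 = 0 -> dist k x < r -> U x.
Proof.
have s_gt0 := s_gt0; have w_gt0 := weight_gt0 k.
move=> /nbhs_ballP[eps /= eps_gt0 epsU].
(* Since [1 < s], every entry of the two eigenvectors is at most [s] in absolute value; [M] then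
   turns a bound on [dist] into one on each coordinate. *)
pose M := s / weight k + s.
have M_gt0 : 0 < M by rewrite addr_gt0// divr_gt0.
exists (eps / M); first exact: divr_gt0.
move=> x x2 dx; apply: epsU.
have dM : s * `|yc x - y0 k| + s * `|zc x - z0 k| < eps.
  move: dx; rewrite ltr_pdivlMr//; apply: le_lt_trans.
  rewrite /dist /M (_ : _ * (s / weight k + s) = s * `|yc x - y0 k| +
    s * `|zc x - z0 k| + (s * weight k * `|yc x - y0 k| +
      s / weight k * `|zc x - z0 k|)); last by field; rewrite lt0r_neq0.
  by rewrite lerDl addr_ge0// mulr_ge0// ltW// mulr_gt0// invr_gt0.
rewrite (pl_coords x x2) /p; split=> // i j.
rewrite /ball /= !mxE; have s1 := s_gt1.
have y_ge0 := normr_ge0 (yc x - y0 k); have z_ge0 := normr_ge0 (zc x - z0 k).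
have aux (c1 c2 c3 : K) : `|c2| <= s -> `|c3| <= s ->
    `|c1 + c2 * y0 k + c3 * z0 k - (c1 + c2 * yc x + c3 * zc x)| < eps.
  move=> c2s c3s; apply: le_lt_trans dM.
  rewrite (_ : _ - _ = - (c2 * (yc x - y0 k) + c3 * (zc x - z0 k)));
    last by ring.
  rewrite normrN (le_trans (ler_normD _ _))// !normrM.
  by apply: lerD; rewrite ler_wpM2r.
case: i => -[|[|[|//]]] i_lt3 /=.
- apply: aux; first by rewrite ger0_norm// ltW.
  by rewrite ler_norml; apply/andP; split; lra.
- rewrite -[z0 k]mul1r -[zc x]mul1r; apply: aux; rewrite ler_norml;
    by apply/andP; split; lra.
- by rewrite subrr normr0.
Qed.

(** In the weighted norm the off-diagonal entries become [2 / (s + 1)] and [(s + 1) / (2 * s)], both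
    below 1. The larger, the second, is the rate; their gap [(s - 1) ^+ 2 / (2 * s * (s + 1))]
    absorbs the diagonal entry [beta * q k]. *)
Lemma dist_contracts k (x : 'cV[K]_3) : x 2 0 = 0 ->
  - beta * q k < (s - 1) ^+ 2 / (2 * s * (s + 1)) ->
  dist k (run x (cyc k)) <= (s + 1) / (2 * s) * dist k x.
Proof.
have [s0 D0 s20 s10] := denominators_neq0; have q_gt0 := q_gt0 k;
have s_gt0 := s_gt0.
have lam_gt0 := lam_gt0; have sD1_gt0 := sD1_gt0.
have Q0 : lam ^+ k != 0 by rewrite -invr_eq0 lt0r_neq0.
have w_gt0 := weight_gt0 k.
move=> x2 beta_lt; have := run_fixed k.
rewrite {1}(pl_coords x x2) /p !run_cycle -/(q k) => pE.
(* Subtracting the fixed-point equation, read coordinate by coordinate, leaves the linear part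
   acting on [u] and [v]. *)
have yE : - lam * (z0 k * q k) = y0 k
  by rewrite -[RHS](yc_pl _ (z0 k)) -pE yc_pl.
have zE : lam ^+ k * y0 k / (s ^+ 2 + 1) + beta * (z0 k * q k) + shift = z0 k.
  by rewrite -[RHS](zc_pl (y0 k)) -pE zc_pl.
rewrite {1}/dist yc_pl zc_pl.
set u := yc x - y0 k; set v := zc x - z0 k.
have -> : - lam * (zc x * q k) - y0 k = - (lam * q k * v).
  by rewrite -yE /v; ring.
have -> : lam ^+ k * yc x / (s ^+ 2 + 1) + beta * (zc x * q k) + shift - z0 k =
    lam ^+ k / (s ^+ 2 + 1) * u + beta * q k * v.
  by rewrite -{1}zE /u /v; ring.
rewrite normrN normrM (gtr0_norm (mulr_gt0 lam_gt0 q_gt0)).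
have -> : weight k * (lam * q k * `|v|) = 2 / (s + 1) * `|v|.
  by rewrite /weight; field; rewrite s10 !lt0r_neq0.
have beta_le0 : beta * q k <= 0.
  by rewrite /beta mulNr mulNr oppr_le0 mulr_ge0 ?divr_ge0// ltW// s2D1_gt0.
have -> : (s + 1) / (2 * s) * dist k x =
    lam ^+ k / (s ^+ 2 + 1) * `|u| + (s + 1) / (2 * s) * `|v|.
  rewrite /dist -/u -/v mulrDr mulrA; congr (_ * _ + _).
  by rewrite /weight /q /lam; field; rewrite s0 s10 s20 -[_ / _]/lam Q0.
have tri : `|lam ^+ k / (s ^+ 2 + 1) * u + beta * q k * v| <=
    lam ^+ k / (s ^+ 2 + 1) * `|u| + - beta * q k * `|v|.
  apply: le_trans (ler_normD _ _) _; rewrite normrM.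
  rewrite [X in _ + X]normrM (ler0_norm beta_le0) -mulNr.
  by rewrite ger0_norm// divr_ge0 ?exprn_ge0// ltW// s2D1_gt0.
have : (2 / (s + 1) - beta * q k) * `|v| <= (s + 1) / (2 * s) * `|v|.
  apply: ler_wpM2r => //; rewrite -lerBrDl.
  rewrite (_ : _ - _ = (s - 1) ^+ 2 / (2 * s * (s + 1))); last first.
    by field; rewrite s0 s10.
  by rewrite -mulNr ltW.
move: tri; rewrite mulrBl mulNr; lra.
Qed.

Lemma eventually_stable_cycle : \forall k \near \oo,
  exists y : 'I_(size (cyc k)) -> 'cV[K]_3,
    [/\ is_cycle AL AR 1 y, admissible y,
        asymptotically_stable (pwl_map AL AR 1) (range y) &
        forall i, ~ Sigma (y i)].
Proof.
have := eventually_bounds; apply: filterS => k [hX hL hR hq].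
have fp := follows_cycle k hX hL hR.
have size_gt0 : (0 < size (cyc k))%N by rewrite size_cat addn2.
have [y [cyc_y adm_y off_y yE]] :=
  cycle_of_fixed_run AL AR 1 (p k) _ size_gt0 fp (run_fixed k).
exists y; split=> //; rewrite yE.
have iter_run x : follows x (cyc k) ->
    iter (size (cyc k)) (pwl_map AL AR 1) x = run x (cyc k).
  by move=> fx; rewrite (follows_iter AL AR 1 x (cyc k))// take_size.
have near_run : \forall x \near p k,
    iter (size (cyc k)) (pwl_map AL AR 1) x = run x (cyc k).
  by have := near_follows AL AR 1 _ _ fp; apply: filterS.
(* Within [dist] less than [r0] of the fixed point, the return map on the plane is the affine [run],
   so the contraction estimate applies to it. *)
have [r0 r0_gt0 r0_run] := dist_nbhs k _ near_run.
have s_gt0 := s_gt0; have s_gt1' := s_gt1.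
have [|||||||stab attr] := @contraction_attracts _ K
  (iter (size (cyc k)) (pwl_map AL AR 1)) (p k) [set x : 'cV[K]_3 | x 2 0 = 0]
    (dist k)
  ((s + 1) / (2 * s)) r0.
- by rewrite divr_ge0 ?ltW ?mulr_gt0 ?sD1_gt0//= ltr_pdivrMr ?mulr_gt0//; lra.
- exact: r0_gt0.
- exact: dist_ge0.
- exact: dist_nbhs.
- by apply: filterS near_run => x /= ->; exact: run_end_R.
- move=> r r_gt0.
  have cd : {for p k, continuous (fun x => dist k (run x (cyc k)))}.
    apply: (@continuous_comp _ _ _ (run^~ (cyc k)) (dist k)).
      exact: run_continuous.
    exact: dist_continuous.
  have : \forall x \near p k, dist k (run x (cyc k)) < r.
    by apply: (cvgr_lt _ cd); rewrite run_fixed dist_cycle_point.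
  by apply: filterS2 near_run => x /= ->.
- move=> x /= x2 dx; rewrite r0_run//; split; first exact: run_end_R.
  exact: dist_contracts.
apply: (orbit_asymptotically_stable _ _ _ size_gt0).
- by rewrite iter_run ?run_fixed.
- move=> i; have [j _ <-] : range y (iter i (pwl_map AL AR 1) (p k)).
    by rewrite yE; exists i.
  exact: pwl_map_continuous_off_Sigma.
- move=> U /stab; apply: filterS => x Ux q'; rewrite iterM; exact: Ux.
- apply: filterS attr => x; under [in X in _ -> X]eq_fun do rewrite iterM.
  by [].
Qed.

End homoclinic_tangency.

Theorem theorem3p1 (K : realType) (sigmaL sigmaR : K)
    (hsigmaR : sigmaR > 1)
    (hsigmaL : sigmaL > (sigmaR - 1) / (sigmaR * (sigmaR ^+ 2 + 1))) :
  let tauR := - (sigmaR + 1) in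
  let deltaL := (1 - sigmaL * sigmaR ^+ 2) / (sigmaR * (sigmaR + 1)) in
  let tauL := 1 / (sigmaR ^+ 2 + 1) - (sigmaL + sigmaR) / (sigmaR + 1) in
  let deltaR := 0 in
  let mu := 1 in
  let AL := companion_mx tauL sigmaL deltaL in
  let AR := companion_mx tauR sigmaR deltaR in
  let f := pwl_map AL AR mu in
  let X : word := [:: R; L; R] in
  let Y : word := [:: L; R] in
  exists kmin : nat, forall k : nat, (kmin <= k)%N ->
    let Z := word_pow k X ++ Y in
    exists x : 'I_(size Z) -> 'cV[K]_3,
      [/\ is_cycle AL AR mu x,
          admissible x,
          asymptotically_stable f (range x) &
          forall i, ~ Sigma (x i)].
Proof.
move=> tauR deltaL tauL deltaR mu AL AR f X Y.
have [kmin _ kP] := eventually_stable_cycle sigmaL sigmaR hsigmaR hsigmaL.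
by exists kmin => k /kP.
Qed.
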